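(* Let $p$ be an odd prime, $r\geq 1$ and $s \geq 0$ be integers. Then the extension $\mathbb{Q}(\zeta_{p^{r+s}})/\mathbb{Q}(\zeta_{p^{r}})^{+}$ is Leopoldt, i.e. the ring of integers $\mathbb{Z}[\zeta_{p^{r+s}}]$ is a free module over the associated order $\mathcal{A}_{\mathbb{Q}(\zeta_{p^{r+s}})/\mathbb{Q}(\zeta_{p^r})^+}$.
   Context: $\zeta_n$ denotes a primitive $n$-th root of unity, $\mathbb{Q}(\zeta_n)$ the $n$-th cyclotomic field and $\mathbb{Q}(\zeta_n)^+$ its maximal real subfield. For a finite Galois extension of number fields $L/K$ with group $G$, the associated order is $\mathcal{A}_{L/K}=\{x\in K[G] : x(\mathcal{O}_L)\subseteq \mathcal{O}_L\}$. An extension $L/K$ of number fields with $L/\mathbb{Q}$ abelian is called Leopoldt if $\mathcal{O}_L$ is a free $\mathcal{A}_{L/K}$-module. *)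

(* Defs.v *)
From HB Require Import structures.
From mathcomp Require Import all_boot all_order all_algebra all_fingroup all_field.
From mathcomp Require Import boolp.

Set Implicit Arguments.
Unset Strict Implicit.
Unset Printing Implicit Defensive.

Import GRing.Theory Num.Theory.
Local Open Scope ring_scope.

Definition free_module (A : nzRingType) (M : lmodType A) : Prop :=
  exists (I : eqType) (b : I -> M),
    (forall (t : seq I) (c : I -> A), uniq t ->
       \sum_(i <- t) c i *: b i = 0 -> {in t, forall i, c i = 0}) /\
    (forall m : M, exists (t : seq I) (c : I -> A), m = \sum_(i <- t) c i *: b i).

Section RingOfIntegers.
Variable L : fieldExtType rat.

Definition int_closure : {pred L} :=
  fun a => `[< integralOver (intr : int -> L) a >].

Lemma int_closureP a :
  reflect (integralOver (intr : int -> L) a) (a \in int_closure).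
Proof. exact: asboolP. Qed.

Fact int_closure_subring : subring_closed int_closure.
Proof.
split=> [|a b /int_closureP Za /int_closureP Zb|a b /int_closureP Za /int_closureP Zb].
- by apply/int_closureP; apply: integral1.
- by apply/int_closureP; apply: integral_sub.
- by apply/int_closureP; apply: integral_mul.
Qed.

HB.instance Definition _ :=
  GRing.isSubringClosed.Build L int_closure int_closure_subring.

Record ringInt := RingInt { int_val :> L; int_valP : int_val \in int_closure }.

HB.instance Definition _ := [isSub for int_val].
HB.instance Definition _ := [Choice of ringInt by <:].
HB.instance Definition _ := [SubChoice_isSubComNzRing of ringInt by <:].

End RingOfIntegers.

Arguments int_closure L : clear implicits.

Section AssociatedOrder.
Variables (L : splittingFieldType rat) (K : {subfield L}).

Local Notation G := ([subg 'Gal({:L} / K)]).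

Definition galalg : Type := {ffun G -> subvs_of K}.

HB.instance Definition _ := GRing.Zmodule.on galalg.

Definition galalg_one : galalg := [ffun g => (g == 1%g)%:R].

(* In gal_of, h * k is "first h, then k". The product below is convolution for *)
(* composition of automorphisms: [h] * [k] = [h \o k] = [k * h].               *)
Definition galalg_mul (x y : galalg) : galalg :=
  [ffun g => \sum_(h : G) x h * y (g * h^-1)%g].

Fact galalg_mulA : associative galalg_mul.
Proof.
move=> x y z; apply/ffunP=> g; rewrite !ffunE.
transitivity (\sum_(h : G) \sum_(k : G) x h * (y (k * h^-1)%g * z (g * k^-1)%g)).
  apply: eq_bigr => h _; rewrite ffunE mulr_sumr.
  rewrite [RHS](reindex_inj (mulIg h)); apply: eq_bigr => k _ /=.
  by rewrite mulgK invMg mulgA.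
rewrite exchange_big; apply: eq_bigr => k _ /=.
by rewrite ffunE mulr_suml; apply: eq_bigr => h _; rewrite mulrA.
Qed.

Fact galalg_mul1l : left_id galalg_one galalg_mul.
Proof.
move=> x; apply/ffunP=> g; rewrite ffunE (bigD1 1%g) //= ffunE eqxx mul1r.
rewrite invg1 mulg1 big1 ?addr0 // => h /negPf nh1.
by rewrite ffunE nh1 mul0r.
Qed.

Fact galalg_mul1r : right_id galalg_one galalg_mul.
Proof.
move=> x; apply/ffunP=> g; rewrite ffunE (bigD1 g) //= ffunE mulgV eqxx mulr1.
rewrite big1 ?addr0 // => h nhg; rewrite ffunE.
by rewrite -eq_mulgV1 eq_sym (negPf nhg) mulr0.
Qed.

Fact galalg_mulDl : left_distributive galalg_mul +%R.
Proof.
move=> x y z; apply/ffunP=> g; rewrite !ffunE -big_split.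
by apply: eq_bigr => h _; rewrite ffunE mulrDl.
Qed.

Fact galalg_mulDr : right_distributive galalg_mul +%R.
Proof.
move=> x y z; apply/ffunP=> g; rewrite !ffunE -big_split.
by apply: eq_bigr => h _; rewrite ffunE mulrDr.
Qed.

Fact galalg_one_neq0 : galalg_one != 0.
Proof.
by apply/eqP=> /ffunP/(_ 1%g)/eqP; rewrite !ffunE eqxx oner_eq0.
Qed.

HB.instance Definition _ := GRing.Zmodule_isNzRing.Build galalg
  galalg_mulA galalg_mul1l galalg_mul1r galalg_mulDl galalg_mulDr
  galalg_one_neq0.

Definition galalg_act (x : galalg) (a : L) : L :=
  \sum_(g : G) vsval (x g) * (sgval g : gal_of {:L}) a.

Lemma galalg_actDl x y a :
  galalg_act (x + y) a = galalg_act x a + galalg_act y a.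
Proof.
by rewrite -big_split; apply: eq_bigr => g _; rewrite ffunE raddfD mulrDl.
Qed.

Lemma galalg_actNl x a : galalg_act (- x) a = - galalg_act x a.
Proof.
by rewrite -sumrN; apply: eq_bigr => g _; rewrite ffunE raddfN mulNr.
Qed.

Lemma galalg_actDr x a b :
  galalg_act x (a + b) = galalg_act x a + galalg_act x b.
Proof.
by rewrite -big_split; apply: eq_bigr => g _; rewrite linearD mulrDr.
Qed.

Lemma galalg_act1 a : galalg_act 1 a = a.
Proof.
rewrite /galalg_act (bigD1 1%g) //= ffunE eqxx /= algid1 mul1r gal_id.
by rewrite big1 ?addr0 // => g /negPf ng1; rewrite ffunE ng1 mul0r.
Qed.

Lemma galalg_actM x y a :
  galalg_act (x * y) a = galalg_act x (galalg_act y a).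
Proof.
rewrite /galalg_act.
transitivity (\sum_(h : G) \sum_(g : G)
    vsval (x h) * vsval (y g) * (sgval (g * h)%g : gal_of {:L}) a).
  transitivity (\sum_(g : G) \sum_(h : G)
      vsval (x h) * vsval (y (g * h^-1)%g) * (sgval g : gal_of {:L}) a).
    by apply: eq_bigr => g _; rewrite ffunE raddf_sum mulr_suml.
  rewrite exchange_big; apply: eq_bigr => h _ /=.
  by rewrite (reindex_inj (mulIg h)); apply: eq_bigr => g _; rewrite mulgK.
apply: eq_bigr => h _; rewrite raddf_sum mulr_sumr; apply: eq_bigr => g _.
rewrite /= rmorphM /= (fixed_gal (subvf K) (subgP h) (subvsP (y g))) mulrA.
by rewrite galM ?memvf.
Qed.

Definition assoc_order : {pred galalg} :=
  fun x => `[< {in int_closure L, forall a, galalg_act x a \in int_closure L} >].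

Lemma assoc_orderP x :
  reflect {in int_closure L, forall a, galalg_act x a \in int_closure L}
          (x \in assoc_order).
Proof. exact: asboolP. Qed.

Fact assoc_order_subring : subring_closed assoc_order.
Proof.
split=> [|x y /assoc_orderP Ax /assoc_orderP Ay|x y /assoc_orderP Ax /assoc_orderP Ay];
  apply/assoc_orderP=> a Oa.
- by rewrite galalg_act1.
- by rewrite galalg_actDl galalg_actNl rpredB ?Ax ?Ay.
- by rewrite galalg_actM Ax ?Ay.
Qed.

HB.instance Definition _ :=
  GRing.isSubringClosed.Build galalg assoc_order assoc_order_subring.

Record assocOrder :=
  AssocOrder { order_val :> galalg; order_valP : order_val \in assoc_order }.

HB.instance Definition _ := [isSub for order_val].
HB.instance Definition _ := [Choice of assocOrder by <:].
HB.instance Definition _ := [SubChoice_isSubNzRing of assocOrder by <:].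

(* Alias of ringInt L that carries the module structure determined by K. *)
Definition ringIntOver (E : {subfield L}) : Type := ringInt L.

HB.instance Definition _ := GRing.Zmodule.on (ringIntOver K).

Definition assoc_scale (x : assocOrder) (a : ringIntOver K) : ringIntOver K :=
  RingInt (assoc_orderP _ (order_valP x) _ (int_valP a)).

Fact assoc_scaleA x y a :
  assoc_scale x (assoc_scale y a) = assoc_scale (x * y) a.
Proof. by apply: val_inj; rewrite /= -galalg_actM. Qed.

Fact assoc_scale1 : left_id 1 assoc_scale.
Proof. by move=> a; apply: val_inj; rewrite /= galalg_act1. Qed.

Fact assoc_scaleDr : right_distributive assoc_scale +%R.
Proof. by move=> x a b; apply: val_inj; rewrite /= -galalg_actDr. Qed.

Fact assoc_scaleDl a : {morph assoc_scale^~ a : x y / x + y}.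
Proof. by move=> x y; apply: val_inj; rewrite /= -galalg_actDl. Qed.

HB.instance Definition _ := GRing.Zmodule_isLmodule.Build assocOrder (ringIntOver K)
  assoc_scaleA assoc_scale1 assoc_scaleDr assoc_scaleDl.

Definition leopoldt : Prop :=
  [/\ galois 1 {:L}, abelian 'Gal({:L} / 1) & free_module (ringIntOver K)].

End AssociatedOrder.

Section MaximalRealSubfield.
Variables (L : fieldExtType rat) (iota : {rmorphism L -> algC}).

Definition real_subfield (K : {subfield L}) : Prop :=
  {in K, forall a, iota a \is Num.real}.

Definition maximal_real_subfield (F K : {subfield L}) : Prop :=
  [/\ (K <= F)%VS, real_subfield K &
      forall K' : {subfield L}, (K' <= F)%VS -> real_subfield K' -> (K' <= K)%VS].

End MaximalRealSubfield.

(* Main.v *)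
From HB Require Import structures.
Require Import Defs.
From mathcomp Require Import all_boot all_order all_algebra all_fingroup all_field.
From mathcomp Require Import boolp ring zify.

(* Write z for the primitive p^(r+s)-th root of unity, F = Q(z^(p^s)) and G for
   the Galois group of L over K = F^+. The ring of integers is Z[z], so it is
   spanned by the powers of z, and it decomposes along the orbits of exponents
   modulo p^s under Gal(L/F): the orbit of j is its class modulo
   D(j) = gcd(p^r j, p^s), and the projector of L onto the span of the z^x with
   x = j mod D(j) is an explicit element of F[Gal(L/F)] preserving Z[z]. Adding
   its complex conjugate gives an element of K[G] in the associated order.
   Choose one exponent j in each nonzero orbit up to sign, and p^s in the zero
   orbit; the sum alpha of the z^j is the generator. Indeed every z^k is
   a(alpha) with a in the associated order: project onto the pair of orbits of
   k and -k, then move inside the orbit by Gal(L/F) or by roots of unity of F,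
   and exchange the two orbits by complex conjugation. On the zero orbit one
   uses that w + 1/w, w = z^(p^s), is a unit of the ring of integers of K and
   that w^(i+1) = (w + 1/w) w^i - w^(i-1). The group being abelian, an x in
   K[G] killing alpha kills every z^k, hence vanishes by independence of
   characters. *)

Set Implicit Arguments.
Unset Strict Implicit.
Unset Printing Implicit Defensive.

Import GRing.Theory Num.Theory.
Local Open Scope ring_scope.

(** * Integral elements of a number field *)

Section IntegralElements.
Variable L : fieldExtType rat.

Lemma int_closure_root1 (x : L) m : (0 < m)%N -> x ^+ m = 1 -> x \in int_closure L.
Proof.
move=> m_gt0 xm1; apply/int_closureP; exists ('X^m - 1 : {poly int}).
  exact: monicXnsubC.
by rewrite rmorphB rmorphXn rmorph1 /= map_polyX rootE !hornerE xm1 subrr.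
Qed.

(** [1%VS] is the copy of Q in [L]; its integral elements become rational algebraic integers of
    [algC], hence integers. *)
Lemma int_closure_rat (x : L) :
  x \in int_closure L -> x \in 1%VS -> exists m : int, x = m%:~R.
Proof.
move=> /int_closureP[q mon_q] + /vlineP[a Dx]; rewrite Dx.
have -> : map_poly (intr : int -> L) q =
          map_poly (in_alg L) (map_poly (intr : int -> rat) q).
  by rewrite -map_poly_comp; apply: eq_map_poly => b /=; rewrite -(rmorph_int (in_alg L)).
rewrite -[a *: 1]/(in_alg L a) fmorph_root => qa0.
have: (ratr a : algC) \in Num.int.
  apply: Cint_rat_Aint; first exact: Crat_rat.
  apply: (@root_monic_Aint (map_poly ratr (map_poly (intr : int -> rat) q))).
  - by rewrite fmorph_root.
  - by rewrite !monic_map.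
  - apply/polyOverP=> i; rewrite !coef_map /= rmorph_int; exact: intr_int.
move=> /intrP[m am]; exists m.
have -> : a = m%:~R by apply: (@fmorph_inj _ algC (@ratr algC)); rewrite [LHS]am rmorph_int.
by rewrite -(rmorph_int (in_alg L)).
Qed.

Lemma invr_nat_not_integral m : (1 < m)%N -> (m%:R^-1 : L) \notin int_closure L.
Proof.
move=> m_gt1; apply/negP=> /int_closure_rat[].
  by rewrite rpredV rpred_nat.
move=> k /(congr1 ( *%R m%:R)).
have m0 : m%:R != 0 :> L.
  by rewrite -(rmorph_nat (in_alg L)) fmorph_eq0 pnatr_eq0 -lt0n ltnW.
rewrite divff // -[m%:R]/((m%:Z)%:~R) -intrM => /esym/eqP.
rewrite -(rmorph_int (in_alg L)) fmorph_eq1.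
rewrite -[1]/(1%:~R) eqr_int => /eqP mk1.
have : (m%:Z %| 1)%Z by apply/dvdzP; exists k; rewrite mulrC.
by rewrite dvdz1 /= => /eqP m1; rewrite m1 in m_gt1.
Qed.

End IntegralElements.

(** * The ring Z[z] *)

Section AdjoinIntegers.
Variable L : fieldExtType rat.

Definition int_adjoin (z : L) : {pred L} :=
  fun x => `[< exists q : {poly int}, x = (map_poly intr q).[z] >].

Lemma int_adjoinP z x :
  reflect (exists q : {poly int}, x = (map_poly intr q).[z]) (x \in int_adjoin z).
Proof. exact: asboolP. Qed.

Fact int_adjoin_subring z : subring_closed (int_adjoin z).
Proof.
split=> [|_ _ /int_adjoinP[q1 ->] /int_adjoinP[q2 ->]
         |_ _ /int_adjoinP[q1 ->] /int_adjoinP[q2 ->]]; apply/int_adjoinP.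
- by exists 1; rewrite rmorph1 hornerE.
- by exists (q1 - q2); rewrite rmorphB !hornerE.
- by exists (q1 * q2); rewrite rmorphM !hornerE.
Qed.

HB.instance Definition _ z :=
  GRing.isSubringClosed.Build L (int_adjoin z) (int_adjoin_subring z).

Lemma int_adjoin_gen z : z \in int_adjoin z.
Proof. by apply/int_adjoinP; exists 'X; rewrite map_polyX hornerX. Qed.

Lemma int_adjoin_spanP z x :
  reflect (exists c : seq int, x = \sum_(i < size c) (c`_i)%:~R * z ^+ i)
          (x \in int_adjoin z).
Proof.
apply: (iffP (int_adjoinP z x)) => [[q ->]|[c ->]].
  exists q; rewrite (horner_coef_wide _ (size_poly _ _)).
  by apply: eq_bigr => i _; rewrite coef_map.
apply/int_adjoinP/rpred_sum => i _.
by rewrite rpredM ?rpred_int ?rpredX ?int_adjoin_gen.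
Qed.

Lemma int_adjoin_integral z :
  z \in int_closure L -> {subset int_adjoin z <= int_closure L}.
Proof.
move=> Oz _ /int_adjoin_spanP[c ->].
by apply: rpred_sum => i _; rewrite rpredM ?rpredX ?rpred_int.
Qed.

Lemma int_adjoin_trans z w : w \in int_adjoin z -> {subset int_adjoin w <= int_adjoin z}.
Proof.
move=> zw _ /int_adjoin_spanP[c ->].
by apply: rpred_sum => i _; rewrite rpredM ?rpredX ?rpred_int.
Qed.

End AdjoinIntegers.

(** * Galois theory of a cyclotomic field over Q *)

Section CyclotomicGalois.
Variables (L : splittingFieldType rat) (N : nat) (z : L).
Hypotheses (z_prim : N.-primitive_root z) (z_gen : <<1; z>>%VS = {:L}%VS).

Lemma num_field_galois : galois 1 {:L}.
Proof.
apply/and3P; split; [exact: subvf | | exact: normalFieldf].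
apply/separableP=> y _; apply/negPn/negP=> /separablePn_pchar[q].
by rewrite pchar_lalg pchar_num.
Qed.

Lemma int_gal (g : gal_of {:L}) x : x \in int_closure L -> g x \in int_closure L.
Proof.
move=> /int_closureP[q mon_q qx0]; apply/int_closureP; exists q => //.
have -> : map_poly (intr : int -> L) q = map_poly g (map_poly (intr : int -> L) q).
  by rewrite -map_poly_comp; apply: eq_map_poly => b; rewrite /= rmorph_int.
by rewrite fmorph_root.
Qed.

Lemma mem_gal1 (g : gal_of {:L}) : g \in 'Gal({:L} / 1)%g.
Proof. by rewrite gal_kHom ?sub1v // k1HomE ahomWin. Qed.

Lemma gal_cyclotomic_inj (g h : gal_of {:L}) : g z = h z -> g = h.
Proof.
move=> eq_gh; apply/eqP/gal_eqP=> a _.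
have /Fadjoin_polyP[q Qq ->] : a \in <<1; z>>%VS by rewrite z_gen memvf.
rewrite -!horner_map /= eq_gh.
by rewrite !(fixedPoly_gal (sub1v _)) ?mem_gal1.
Qed.

Lemma gal_cyclotomic_exp (g : gal_of {:L}) : exists i, g z = z ^+ i.
Proof.
have /(prim_rootP z_prim)[i ->] : g z ^+ N = 1.
  by rewrite -rmorphXn /= (prim_expr_order z_prim) rmorph1.
by exists i.
Qed.

Lemma gal_cyclotomic_abelian : abelian 'Gal({:L} / 1).
Proof.
apply/centsP=> g _ h _; apply: gal_cyclotomic_inj.
rewrite !galM ?memvf //.
have [i gz] := gal_cyclotomic_exp g; have [j hz] := gal_cyclotomic_exp h.
by rewrite gz hz !rmorphXn /= gz hz exprAC.
Qed.

(* Fourier inversion: [\sum_k (z / g z) ^+ k] vanishes unless [g = 1]. *)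
Lemma cyclotomic_trace_expansion x :
  \sum_(k < N) galTrace 1 {:L} (x / z ^+ k) * z ^+ k = N%:R * x.
Proof.
have z0 : z != 0 by rewrite (prim_root_eq0 z_prim) -lt0n (prim_order_gt0 z_prim).
under eq_bigr => k _ do rewrite mulr_suml.
rewrite exchange_big (bigD1 1%g) ?group1 //= [X in _ + X]big1 ?addr0.
  under eq_bigr => k _ do rewrite gal_id divfK ?expf_neq0 //.
  by rewrite sumr_const card_ord mulr_natl.
move=> g /andP[_ ng1]; have gz0 : g z != 0 by rewrite fmorph_eq0.
under eq_bigr => k _.
  rewrite rmorphM fmorphV rmorphXn /= -mulrA -exprVn -exprMn.
  over.
rewrite -mulr_sumr; set w := _ * z.
have w1 : 1 - w != 0.
  rewrite subr_eq0 eq_sym /w mulrC; apply: contra ng1 => /eqP/(divr1_eq)/esym gz.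
  by apply/eqP/gal_cyclotomic_inj; rewrite gal_id.
suff /eqP : (1 - w) * (\sum_(k < N) w ^+ k) = 0.
  by rewrite mulf_eq0 (negPf w1) => /eqP->; rewrite mulr0.
apply/eqP; rewrite -[1 - w]opprB mulNr oppr_eq0 -subrX1 subr_eq0.
rewrite exprMn exprVn -rmorphXn /= (prim_expr_order z_prim) rmorph1.
by rewrite mulr1 invr1.
Qed.

End CyclotomicGalois.

(** * The ring of integers of a cyclotomic field of prime power order *)

Section CyclotomicIntegers.
Variables (L : splittingFieldType rat) (p n : nat) (z : L).
Hypotheses (p_pr : prime p) (n_gt0 : (0 < n)%N).
Hypotheses (z_prim : (p ^ n).-primitive_root z) (z_gen : <<1; z>>%VS = {:L}%VS).

Local Notation O := (int_closure L).
Local Notation Zz := (int_adjoin z).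
Local Notation lam := (z - 1).

Lemma cyclotomic_gen_integral : z \in O.
Proof.
exact: int_closure_root1 (prim_order_gt0 z_prim) (prim_expr_order z_prim).
Qed.

Lemma root_sub1_dvd_exp k : exists2 y, y \in Zz & z ^+ k - 1 = lam * y.
Proof.
exists (\sum_(i < k) z ^+ i).
  by apply: rpred_sum => i _; rewrite rpredX ?int_adjoin_gen.
by rewrite subrX1.
Qed.

(** For [w] of order [p], the vanishing sum of its powers writes [p] as minus the sum of the
    [w ^+ i - 1], all multiples of [z - 1]. *)
Lemma root_sub1_dvd_prime : exists2 y, y \in Zz & p%:R = lam * y.
Proof.
set w := z ^+ (p ^ n.-1).
have w_prim : p.-primitive_root w.
  have := dvdn_prim_root z_prim (m := p).
  rewrite -{2}(prednK n_gt0) expnS mulKn ?prime_gt0 //; apply.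
  by rewrite dvdn_exp.
have sum0 : \sum_(i < p) w ^+ i = 0.
  have /eqP := prim_expr_order w_prim.
  rewrite -subr_eq0 subrX1 mulf_eq0 subr_eq0 => /orP[/eqP w1|/eqP//].
  have := prim_order_dvd w_prim 1; rewrite expr1 w1 eqxx dvdn1 => /eqP p1.
  by move: p_pr; rewrite p1.
have -> : p%:R = - \sum_(i < p) (w ^+ i - 1) :> L.
  by rewrite sumrB sum0 sub0r opprK sumr_const card_ord.
suff [y Zy ->] : exists2 y, y \in Zz & \sum_(i < p) (w ^+ i - 1) = lam * y.
  by exists (- y); rewrite ?rpredN ?mulrN.
elim/big_ind: _ => [|_ _ [y1 Zy1 ->] [y2 Zy2 ->]|i _].
- by exists 0; rewrite ?rpred0 ?mulr0.
- by exists (y1 + y2); rewrite ?rpredD ?mulrDr.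
- by rewrite -exprM; apply: root_sub1_dvd_exp.
Qed.

Lemma int_adjoin_frobenius a b : a \in Zz -> b \in Zz ->
  exists2 y, y \in Zz & (a + b) ^+ p = a ^+ p + b ^+ p + p%:R * y.
Proof.
move=> Za Zb; rewrite exprDn -(prednK (prime_gt0 p_pr)).
set q := p.-1; rewrite big_ord_recl big_ord_recr /= subn0 subnn.
rewrite !expr0 !mulr1 !mul1r bin0 binn !mulr1n.
(* The two extreme terms being split off, [bump 0 i] is [i + 1] and the remaining binomial
   coefficients are multiples of [p = q.+1]. *)
exists (\sum_(i < q) a ^+ (q.+1 - bump 0 i) * b ^+ bump 0 i
          *+ ('C(q.+1, bump 0 i) %/ q.+1)).
  by apply: rpred_sum => i _; rewrite rpredMn // rpredM // rpredX.
rewrite -!addrA [b ^+ _ + _]addrC; congr (_ + (_ + _)).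
rewrite mulr_sumr; apply: eq_bigr => i _.
rewrite mulr_natl -mulrnA divnK // /q (prednK (prime_gt0 p_pr)).
apply: prime_dvd_bin => //=; rewrite /bump /=.
by have := ltn_ord i; rewrite /q; lia.
Qed.

(** By iterated Frobenius congruences, [lam ^+ (p ^ m)] agrees modulo [p] with [z ^+ (p ^ m) - 1],
    which vanishes for [m = n]. *)
Lemma prime_dvd_root_sub1_exp :
  exists2 y, y \in Zz & lam ^+ (p ^ n) = p%:R * y.
Proof.
suff [y Zy Dy] : exists2 y, y \in Zz & lam ^+ (p ^ n) = z ^+ (p ^ n) - 1 + p%:R * y.
  by exists y; rewrite // Dy (prim_expr_order z_prim) subrr add0r.
elim: n => [|m [y Zy IH]]; first by exists 0; rewrite ?rpred0 ?mulr0 ?addr0.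
have Zw : z ^+ (p ^ m) - 1 \in Zz by rewrite rpredB ?rpred1 ?rpredX ?int_adjoin_gen.
have Zpy : p%:R * y \in Zz by rewrite rpredM ?rpred_nat.
have [y1 Zy1 E1] := int_adjoin_frobenius Zw Zpy.
(* Adding 1 to [z ^+ (p ^ m) - 1] before taking [p]-th powers relates its [p]-th power to
   [z ^+ (p ^ m.+1) - 1]. *)
have [y2 Zy2] := int_adjoin_frobenius Zw (rpred1 _).
rewrite subrK expr1n => E2.
exists (p%:R ^+ p.-1 * y ^+ p + y1 - y2).
  by rewrite rpredB // rpredD // rpredM ?rpredX ?rpred_nat.
rewrite expnSr !exprM IH E1 E2 exprMn.
have -> : p%:R ^+ p = p%:R * p%:R ^+ p.-1 :> L.
  by rewrite -exprS prednK ?prime_gt0.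
ring.
Qed.

Lemma root_sub1_neq0 : lam != 0.
Proof.
rewrite subr_eq0; apply/eqP=> z1.
have := prim_order_dvd z_prim 1; rewrite expr1 z1 eqxx dvdn1.
by rewrite -(expn0 p) eqn_exp2l ?prime_gt1 // => /eqP n0; move: n_gt0; rewrite n0.
Qed.

(** Otherwise a Bezout relation between [p] and [m], both multiples of [lam], makes [lam] a unit;
    then [p], a divisor of a power of [lam], is a unit too, but its inverse is not integral. *)
Lemma prime_dvd_int_root_sub1 (m : int) y :
  y \in O -> m%:~R = lam * y -> (p %| m)%Z.
Proof.
move=> Oy Dm; apply/negPn/negP=> pm.
have OZ := int_adjoin_integral cyclotomic_gen_integral.
have [t [v Buv]] : exists t v : int, t * p%:Z + v * m = 1.
  have [t [v Btv]] := Bezoutz p m; exists t, v; rewrite Btv.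
  apply/eqP; change (coprimez p m).
  by rewrite coprimezE prime_coprime.
have [y1 Zy1 Dp] := root_sub1_dvd_prime.
have [y2 Zy2 Dl] := prime_dvd_root_sub1_exp.
set x := t%:~R * y1 + v%:~R * y.
have Ox : x \in O by rewrite rpredD // rpredM ?rpred_int // OZ.
have lx1 : lam * x = 1.
  rewrite mulrDr !(mulrCA lam) -Dp -Dm -[p%:R]/((p%:Z)%:~R) -!intrM -intrD.
  by rewrite Buv.
have p0 : p%:R != 0 :> L.
  by rewrite -(rmorph_nat (in_alg L)) fmorph_eq0 pnatr_eq0 -lt0n prime_gt0.
suff : (p%:R^-1 : L) \in O by apply/negP/invr_nat_not_integral/prime_gt1.
suff -> : p%:R^-1 = y2 * x ^+ (p ^ n) by rewrite rpredM ?rpredX // OZ.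
apply: (mulfI p0); rewrite divff // mulrA -Dl -exprMn lx1 expr1n.
by [].
Qed.

(** Expand [lam * y] in powers of [lam]: the constant term is a multiple of [lam] in [O], hence of
    [p], hence of [lam] in Z[z], and [lam] cancels. *)
Lemma root_sub1_saturated y : y \in O -> lam * y \in Zz -> y \in Zz.
Proof.
move=> Oy Zly.
have [q Dq] : exists q : {poly int}, lam * y = (map_poly intr q).[lam].
  have/int_adjoinP[q ->] := Zly; exists (q \Po ('X + 1)).
  by rewrite map_comp_poly rmorphD rmorph1 /= map_polyX horner_comp !hornerE subrK.
have [q1 [m Dqm]] : exists q1 (m : int), q = q1 * 'X + m%:P.
  elim/poly_ind: q {Dq} => [|q1 m _]; last by exists q1, m.
  by exists 0, 0; rewrite mul0r addr0.
have Zl : lam \in Zz by rewrite rpredB ?rpred1 ?int_adjoin_gen.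
pose y1 := (map_poly (intr : int -> L) q1).[lam].
have Zy1 : y1 \in Zz.
  by apply: (int_adjoin_trans Zl); apply/int_adjoinP; exists q1.
have Dly : lam * y = lam * y1 + m%:~R.
  rewrite Dq Dqm rmorphD rmorphM /= map_polyX map_polyC !hornerE.
  by rewrite mulrC.
have /dvdzP[k Dm] : (p %| m)%Z.
  apply: (@prime_dvd_int_root_sub1 m (y - y1)).
    rewrite rpredB //; exact: int_adjoin_integral cyclotomic_gen_integral _ Zy1.
  by rewrite mulrBr Dly; ring.
have [y2 Zy2 Dp] := root_sub1_dvd_prime.
suff -> : y = y1 + k%:~R * y2 by rewrite rpredD ?rpredM ?rpred_int.
apply: (mulfI root_sub1_neq0); rewrite Dly Dm intrM mulrDr.
by rewrite mulrCA -Dp.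
Qed.

(* The trace expansion bounds the denominators by [p ^ n], hence by a power of
   [z - 1]; they are then removed one factor [z - 1] at a time. *)
Theorem cyclotomic_integers : int_closure L =i int_adjoin z.
Proof.
move=> x; apply/idP/idP; last exact: int_adjoin_integral cyclotomic_gen_integral x.
move=> Ox; have z0 : z != 0.
  by rewrite (prim_root_eq0 z_prim) -lt0n (prim_order_gt0 z_prim).
have Zpx : (p ^ n)%:R * x \in Zz.
  rewrite -(cyclotomic_trace_expansion z_prim z_gen); apply: rpred_sum => k _.
  rewrite rpredM ?rpredX ?int_adjoin_gen //.
  have [||m ->] := @int_closure_rat L (galTrace 1 {:L} (x / z ^+ k)).
  - apply: rpred_sum => g _; apply: int_gal; rewrite rpredM //.
    rewrite -exprVn rpredX //.
    apply: int_closure_root1 (prim_order_gt0 z_prim) _.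
    by rewrite exprVn (prim_expr_order z_prim) invr1.
  - by rewrite mem_galTrace ?num_field_galois ?memvf.
  - by rewrite rpred_int.
have [y Zy Dl] := prime_dvd_root_sub1_exp.
have : lam ^+ (p ^ n * n) * x \in Zz.
  rewrite exprM Dl exprMn -natrX mulrAC rpredM ?rpredX //.
have Zl : lam \in Zz by rewrite rpredB ?rpred1 ?int_adjoin_gen.
have OZ := int_adjoin_integral cyclotomic_gen_integral.
elim: (p ^ n * n)%N => [|m IH]; first by rewrite mul1r.
rewrite exprS -mulrA => /root_sub1_saturated Zlx; apply/IH/Zlx.
by rewrite rpredM // rpredX ?OZ.
Qed.

End CyclotomicIntegers.

(** * The group algebra as operators on the field, and freeness of rank one *)

Section GroupAlgebra.
Variables (L : splittingFieldType rat) (K : {subfield L}).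

Local Notation O := (int_closure L).

(** Elements of K[G] are handled through the maps they induce on [L], so that projectors and
    automorphisms combine without computing coefficients. *)
Definition galalg_op (T : L -> L) : Prop :=
  exists x : galalg K, galalg_act x =1 T.

Definition order_op (T : L -> L) : Prop :=
  exists2 x : galalg K, x \in @assoc_order L K & galalg_act x =1 T.

Lemma eq_galalg_op T1 T2 : T1 =1 T2 -> galalg_op T1 -> galalg_op T2.
Proof. by move=> eqT [x Dx]; exists x => a; rewrite Dx eqT. Qed.

Lemma galalg_op_gal a g :
  a \in K -> g \in 'Gal({:L} / K)%g -> galalg_op (fun b => a * g b).
Proof.
move=> Ka Gg; exists [ffun h => if sgval h == g then vsproj K a else 0] => b.
rewrite /galalg_act (bigD1 (subg _ g)) //= ffunE subgK // eqxx vsprojK //.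
rewrite [X in _ + X]big1 ?addr0; first by [].
move=> h hg; rewrite ffunE; case: eqP => [Dh|_]; last by rewrite mul0r.
by rewrite -Dh sgvalK eqxx in hg.
Qed.

Lemma galalg_opD T1 T2 :
  galalg_op T1 -> galalg_op T2 -> galalg_op (fun b => T1 b + T2 b).
Proof.
by move=> [x Dx] [y Dy]; exists (x + y) => b; rewrite galalg_actDl Dx Dy.
Qed.

Lemma galalg_op_sum m (T : 'I_m -> L -> L) :
  (forall i, galalg_op (T i)) -> galalg_op (fun b => \sum_(i < m) T i b).
Proof.
elim: m T => [|m IH] T opT.
  exists 0 => b; rewrite big_ord0 /galalg_act big1 // => g _.
  by rewrite ffunE mul0r.
apply: eq_galalg_op (galalg_opD (IH _ (fun i => opT (widen_ord (leqnSn m) i))) (opT ord_max)).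
by move=> b; rewrite big_ord_recr.
Qed.

Lemma order_op_comp T1 T2 : order_op T1 -> order_op T2 -> order_op (T1 \o T2).
Proof.
move=> [x Ax Dx] [y Ay Dy]; exists (x * y); first by rewrite rpredM.
by move=> b; rewrite galalg_actM Dx Dy.
Qed.

Lemma order_opD T1 T2 :
  order_op T1 -> order_op T2 -> order_op (fun b => T1 b + T2 b).
Proof.
move=> [x Ax Dx] [y Ay Dy]; exists (x + y); first by rewrite rpredD.
by move=> b; rewrite galalg_actDl Dx Dy.
Qed.

Lemma order_opB T1 T2 :
  order_op T1 -> order_op T2 -> order_op (fun b => T1 b - T2 b).
Proof.
move=> [x Ax Dx] [y Ay Dy]; exists (x - y); first by rewrite rpredB.
by move=> b; rewrite galalg_actDl galalg_actNl Dx Dy.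
Qed.

Lemma order_op_gal a g :
  a \in K -> a \in O -> g \in 'Gal({:L} / K)%g -> order_op (fun b => a * g b).
Proof.
move=> Ka Oa Gg; have [x Dx] := galalg_op_gal Ka Gg; exists x => //.
by apply/assoc_orderP=> b Ob; rewrite Dx rpredM // int_gal.
Qed.

Lemma galalg_act0r (x : galalg K) : galalg_act x 0 = 0.
Proof. by rewrite /galalg_act big1 // => g _; rewrite raddf0 mulr0. Qed.

Lemma galalg_actZr (x : galalg K) d b :
  d \in K -> galalg_act x (d * b) = d * galalg_act x b.
Proof.
move=> Kd; rewrite /galalg_act mulr_sumr; apply: eq_bigr => g _.
by rewrite rmorphM /= (fixed_gal (subvf K) (subgP g) Kd) mulrCA.
Qed.

Lemma galalg_act_sum (x : galalg K) m (c v : 'I_m -> L) :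
    (forall i, c i \in K) ->
  galalg_act x (\sum_i c i * v i) = \sum_i c i * galalg_act x (v i).
Proof.
move=> Kc; rewrite (big_morph _ (galalg_actDr x) (galalg_act0r x)).
by apply: eq_bigr => i _; rewrite galalg_actZr.
Qed.

(** Dedekind's independence of characters, with the coefficients of [x] as scalars. *)
Lemma galalg_act_inj (x : galalg K) : galalg_act x =1 (fun _ => 0) -> x = 0.
Proof.
move=> x0; apply/ffunP=> g; rewrite ffunE; apply: val_inj => /=.
have := @gal_independent _ _ {:L} (mem 'Gal({:L} / K)%g)
  (fun h => vsval (x (subg _ h))).
move=> /(_ _ (sgval g) (subgP g)); rewrite sgvalK; apply=> a _.
rewrite -[RHS](x0 a) /galalg_act.
rewrite (reindex_onto (subg 'Gal({:L} / K)) sgval) /=; last by move=> h _; rewrite sgvalK.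
apply: eq_big => h; first by apply/idP/eqP=> [/subgK //|<-]; exact: subgP.
by move=> Gh; rewrite subgK.
Qed.

Lemma galalg_mulC : abelian 'Gal({:L} / K) -> commutative (@GRing.mul (galalg K)).
Proof.
move=> /centsP abG x y; apply/ffunP=> g; rewrite !ffunE.
rewrite (reindex_inj (inj_comp (mulIg g) invg_inj)) /=.
apply: eq_bigr => h _; rewrite mulrC invMg invgK; congr (y _ * x _).
  by rewrite mulKVg.
by apply: val_inj; apply: abG; apply: subgP.
Qed.

(** K[G] is commutative and every integer is some [T alpha], so an element killing [alpha] kills [O]
    and is zero. *)
Lemma assoc_order_free_rank1 (alpha : L) :
    abelian 'Gal({:L} / K) -> alpha \in O ->
    (forall x : galalg K, {in O, galalg_act x =1 (fun _ => 0)} -> x = 0) ->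
    (forall a, a \in O -> exists2 T, order_op T & T alpha = a) ->
  free_module (ringIntOver K).
Proof.
move=> abG Oalpha inj_act gen.
exists unit, (fun _ => RingInt Oalpha : ringIntOver K); split=> [t c ut c0 [] t0|m].
  (* The index type [unit] allows only one term in a relation. *)
  have Dt : t = [:: tt] by case: t ut t0 {c0} => [|[] [|[] t]].
  move: c0; rewrite Dt big_seq1 => /(congr1 (@int_val L)) /= c0.
  apply: val_inj => /=; apply: inj_act => a /gen[T [x Ax Dx] <-].
  by rewrite -Dx -galalg_actM galalg_mulC // galalg_actM c0 galalg_act0r.
have [T [x Ax Dx] Dm] := gen _ (int_valP m).
exists [:: tt], (fun _ => AssocOrder Ax); rewrite big_seq1.
by apply: val_inj; rewrite /= Dx Dm.
Qed.

End GroupAlgebra.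

(** * Integer powers of a root of unity *)

Section IntegerPowers.
Variables (F : fieldType) (N : nat) (z : F).
Hypothesis z_prim : N.-primitive_root z.

Lemma prim_root_neq0 : z != 0.
Proof. by rewrite (prim_root_eq0 z_prim) -lt0n (prim_order_gt0 z_prim). Qed.

Lemma prim_order_dvdz (m : int) : (N %| m)%Z = (z ^ m == 1).
Proof.
case: m => m; first exact: prim_order_dvd.
rewrite dvdzE /= (prim_order_dvd z_prim) NegzE -exprnN.
by rewrite invr_eq1.
Qed.

Lemma eq_prim_rootz (k m : int) : (N %| k - m)%Z -> z ^ k = z ^ m.
Proof.
rewrite prim_order_dvdz => /eqP zkm; rewrite -[k](subrK m).
by rewrite expfzDr ?prim_root_neq0 // zkm mul1r.
Qed.

Lemma exprz_modz (k : int) : z ^ k = z ^+ `|(k %% N)%Z|%N.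
Proof.
have N0 : N%:Z != 0 by have := prim_order_gt0 z_prim; lia.
rewrite [RHS]exprnP gez0_abs ?modz_ge0 //; apply: eq_prim_rootz.
by rewrite {1}(divz_eq k N) addrK dvdz_mull.
Qed.

(** A geometric series of ratio [z ^ y], whose [N]-th power is 1. *)
Lemma sum_prim_rootz (y : int) :
  \sum_(w < N) z ^ (y * w%:Z) = if (N %| y)%Z then N%:R else 0.
Proof.
case: ifPn => Ny.
  under eq_bigr => w _.
    have /eqP-> : z ^ (y * w%:Z) == 1 by rewrite -prim_order_dvdz dvdz_mulr.
    over.
  by rewrite sumr_const card_ord.
under eq_bigr => w _ do rewrite -exprz_exp -exprnP.
apply/eqP; have /eqP := subrX1 (z ^ y) N.
rewrite exprnP exprz_exp mulrC -exprz_exp -exprnP (prim_expr_order z_prim) exp1rz.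
rewrite subrr eq_sym mulf_eq0 subr_eq0 -prim_order_dvdz (negPf Ny) /=.
by under eq_bigr => w _ do rewrite exprnP.
Qed.

End IntegerPowers.

(** * Orbits of exponents and their representatives *)

Section ExponentOrbits.
Variables (p r s : nat).
Hypotheses (p_pr : prime p) (r_gt0 : (1 <= r)%N).

Local Notation pr := ((p ^ r)%N%:Z).
Let p_gt0 : (0 < p)%N. Proof. exact: prime_gt0. Qed.
Local Notation q := ((p ^ s)%N%:Z).
Let q0 : q != 0. Proof. by have : (0 < p ^ s)%N by [rewrite expn_gt0 p_gt0]; lia. Qed.

(* The Galois orbit of an exponent [k] modulo [p ^ s], under the automorphisms
   fixing [zr], is its residue class modulo [orbit_mod k]. *)
Definition orbit_mod (k : int) : int := gcdz (pr * k) q.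

Lemma orbit_modN k : orbit_mod (- k) = orbit_mod k.
Proof. by rewrite /orbit_mod mulrN gcdNz. Qed.

Lemma orbit_mod_dvd k : (orbit_mod k %| q)%Z.
Proof. exact: dvdz_gcdr. Qed.

Lemma gcdz_pfactor (k : int) m :
  exists2 M, (M <= m)%N & gcdz k (p ^ m)%N = (p ^ M)%N.
Proof.
have /(dvdn_pfactor _ _ p_pr)[M le_Mm DM] : (gcdn `|k| (p ^ m) %| p ^ m)%N.
  exact: dvdn_gcdr.
by exists M; rewrite // /gcdz /= DM.
Qed.

Lemma orbit_modP k : exists2 M, (M <= s)%N & orbit_mod k = (p ^ M)%N.
Proof. exact: gcdz_pfactor. Qed.

Lemma dvdz_pexp m m' : ((p ^ m)%N %| (p ^ m')%N%:Z)%Z = (m <= m')%N.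
Proof. by rewrite dvdzE /= dvdn_Pexp2l ?prime_gt1. Qed.

Lemma orbit_mod_max k M m : orbit_mod k = (p ^ M)%N ->
  (m <= s)%N -> ((p ^ m)%N %| pr * k)%Z -> (m <= M)%N.
Proof. by move=> DM ms dm; rewrite -dvdz_pexp -DM dvdz_gcd dm dvdz_pexp. Qed.

Lemma orbit_mod_top k : (q %| k)%Z -> orbit_mod k = q.
Proof. by move=> qk; rewrite /orbit_mod (gcdz_idPr _) // dvdz_mull. Qed.

(** Moving [k] by a multiple of [p ^ M] moves [pr * k] by a multiple of [p ^ (M + 1)], because [r]
    is positive; the gcd [p ^ M] with [q] does not change. *)
Lemma orbit_mod_eq k j : (orbit_mod k %| k - j)%Z -> orbit_mod j = orbit_mod k.
Proof.
have [M le_Ms DM] := orbit_modP k; have [M' le_M's DM'] := orbit_modP j.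
rewrite DM DM' => dkj.
have Dk : pr * k = pr * j + pr * (k - j) by ring.
have dk : ((p ^ M)%N %| pr * k)%Z by rewrite -DM dvdz_gcdl.
have dj : ((p ^ M')%N %| pr * j)%Z by rewrite -DM' dvdz_gcdl.
have dd m : (m <= r + M)%N -> ((p ^ m)%N %| pr * (k - j))%Z.
  rewrite -dvdz_pexp => /dvdz_trans; apply.
  by rewrite expnD PoszM dvdz_mul.
have le1 : (M <= M')%N.
  apply: (orbit_mod_max DM') => //.
  have -> : pr * j = pr * k - pr * (k - j) by ring.
  by rewrite rpredB // dd //; lia.
have [le2|lt2] := leqP M' M; first by congr (Posz (p ^ _)); lia.
have : (M.+1 <= M)%N; last by rewrite ltnn.
apply: (orbit_mod_max DM); first by lia.
rewrite Dk rpredD ?dd //; last by lia.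
by apply: dvdz_trans dj; rewrite dvdz_pexp.
Qed.

(** Classes are taken up to sign because complex conjugation belongs to Gal(L/K). *)
Definition orbit_rel (k j : int) : bool :=
  (orbit_mod k %| k - j)%Z || (orbit_mod k %| k + j)%Z.

Lemma orbit_rel_mod k j : orbit_rel k j -> orbit_mod j = orbit_mod k.
Proof.
move=> /orP[/orbit_mod_eq //|]; rewrite -[j in k + j]opprK => /orbit_mod_eq <-.
by rewrite orbit_modN.
Qed.

Lemma orbit_rel_refl k : orbit_rel k k.
Proof. by rewrite /orbit_rel subrr dvdz0. Qed.

Lemma orbit_rel_class k j : orbit_rel k j -> orbit_rel k =1 orbit_rel j.
Proof.
move=> Rkj i; rewrite /orbit_rel (orbit_rel_mod Rkj); set d := orbit_mod k.
have := Rkj; rewrite /orbit_rel -/d => /orP[dkj|dkj].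
  have -> : k - i = (k - j) + (j - i) by ring.
  have -> : k + i = (k - j) + (j + i) by ring.
  by rewrite !(rpredDl _ dkj).
have -> : k - i = (k + j) - (j + i) by ring.
have -> : k + i = (k + j) - (j - i) by ring.
by rewrite !(rpredBl _ dkj) orbC.
Qed.

(** This separates a nonzero orbit from its negative. As [p] is odd, the factor 2 cancels; then
    [p ^ M] divides [k] and [p ^ (M + 1)] divides [pr * k], which forces [M = s]. *)
Lemma orbit_mod_double k : odd p -> ~~ (q %| k)%Z -> ~~ (orbit_mod k %| k + k)%Z.
Proof.
have [M le_Ms DM] := orbit_modP k; rewrite DM => p_odd; apply: contra => d2.
have dk : ((p ^ M)%N %| k)%Z.
  have : ((p ^ M)%N %| 2%:Z * k)%Z by have -> : 2%:Z * k = k + k by ring.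
  rewrite Gauss_dvdzr // coprimezE /= coprimeXl // coprime_sym prime_coprime //.
  by rewrite dvdn2 p_odd.
have [DMs|ltMs] : M = s \/ (M < s)%N by lia.
  by rewrite -DMs.
have : (M.+1 <= M)%N; last by rewrite ltnn.
apply: (orbit_mod_max DM) => //.
by rewrite expnS PoszM dvdz_mul // -[p%:Z]/((p ^ 1)%N%:Z) dvdz_pexp.
Qed.

(** [choose] returns the same exponent on a whole class. The zero class gets [q] and not [0], since
    [z ^ 0 = 1] is fixed by the Galois group and generates only elements of [K]. *)
Definition orbit_rep (k : int) : int :=
  if (q %| k)%Z then q else choose (orbit_rel k) k.

Lemma orbit_rel_dvd k j : orbit_rel k j -> (q %| k)%Z = (q %| j)%Z.
Proof.
have orbit_top i : (q %| i)%Z = (q %| i)%Z && (orbit_mod i == q).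
  by case: (boolP (q %| i)%Z) => // /orbit_mod_top->; rewrite eqxx.
move=> Rkj; rewrite orbit_top [RHS]orbit_top (orbit_rel_mod Rkj).
case: eqP => [Dk|]; rewrite ?andbF // !andbT.
move: Rkj; rewrite /orbit_rel Dk => /orP[qkj|qkj].
  by rewrite -{1}(subrK j k) (rpredDl _ qkj).
by rewrite -{1}(addrK j k) (rpredBl _ qkj).
Qed.

Lemma orbit_rep_rel k : orbit_rel k (orbit_rep k).
Proof.
rewrite /orbit_rep; case: ifP => [qk|_]; last exact: chooseP (orbit_rel_refl k).
by rewrite /orbit_rel orbit_mod_top // rpredB.
Qed.

Lemma eq_orbit_rep k j : orbit_rel k j -> orbit_rep k = orbit_rep j.
Proof.
move=> Rkj; rewrite /orbit_rep (orbit_rel_dvd Rkj); case: ifP => // _.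
rewrite (eq_choose (orbit_rel_class Rkj)); apply: choose_id.
  by rewrite -(orbit_rel_class Rkj) orbit_rel_refl.
exact: orbit_rel_refl.
Qed.

Definition orbit_reps : seq int := undup [seq orbit_rep i%:Z | i <- iota 0 (p ^ s)].

Lemma orbit_rep_mem k : orbit_rep k \in orbit_reps.
Proof.
rewrite mem_undup; apply/mapP; exists `|(k %% q)%Z|%N.
  rewrite mem_iota /= add0n; have := ltz_mod k q0; have := modz_ge0 k q0; lia.
apply: eq_orbit_rep; rewrite gez0_abs ?modz_ge0 //; apply/orP; left.
have -> : k - (k %% q)%Z = (k %/ q)%Z * q by rewrite {1}(divz_eq k q) addrK.
by rewrite dvdz_mull ?orbit_mod_dvd.
Qed.

Lemma orbit_reps_eq j k : j \in orbit_reps -> k \in orbit_reps -> orbit_rel j k -> j = k.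
Proof.
rewrite !mem_undup => /mapP[j' _ ->] /mapP[k' _ ->] /eq_orbit_rep.
by rewrite -!(eq_orbit_rep (orbit_rep_rel _)).
Qed.

(** The units [u] stand for automorphisms over [F], which thus carry [z ^ j] to every power in the
    class of [j]. *)
Lemma orbit_transitive j k : orbit_mod j != q -> (orbit_mod j %| k - j)%Z ->
  exists2 u : int, (pr %| u - 1)%Z & ((p ^ (r + s))%N %| k - u * j)%Z.
Proof.
have [M le_Ms DM] := orbit_modP j; rewrite DM => ltMs /dvdzP[t Dkj].
have {}ltMs : (M < s)%N.
  by rewrite ltn_neqAle le_Ms andbT; apply: contraNneq ltMs => ->.
(* As [M < s], replacing [q] by [p ^ (r + s)] leaves the gcd equal to [p ^ M]. *)
have [M' le_M' DM'] := gcdz_pfactor (pr * j) (r + s).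
have dM' : ((p ^ M')%N %| pr * j)%Z by rewrite -DM' dvdz_gcdl.
have dM : ((p ^ M)%N %| pr * j)%Z by rewrite -DM dvdz_gcdl.
have le1 : (M <= M')%N.
  by rewrite -dvdz_pexp -DM' dvdz_gcd dM dvdz_pexp; lia.
have le2 : (M' <= M)%N.
  rewrite leqNgt; apply/negP=> ltM; have : (M.+1 <= M)%N; last by rewrite ltnn.
  apply: (orbit_mod_max DM) => //; apply: dvdz_trans dM'.
  by rewrite dvdz_pexp.
have [u [v Buv]] := Bezoutz (pr * j) (p ^ (r + s))%N.
(* Modulo [p ^ (r + s)], [u * (pr * j)] is [p ^ M], so this multiplier sends [j] to [j + t * p ^ M],
   which is [k]. *)
exists (1 + t * u * pr); first by rewrite (addrC 1) addrK dvdz_mull.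
have -> : k - (1 + t * u * pr) * j = t * v * (p ^ (r + s))%N%:Z.
  have -> : k = t * (p ^ M)%N%:Z + j by rewrite -Dkj subrK.
  have -> : (p ^ M)%N%:Z = u * (pr * j) + v * (p ^ (r + s))%N%:Z.
    by rewrite Buv DM'; congr (Posz (p ^ _)); lia.
  ring.
by rewrite dvdz_mull.
Qed.

End ExponentOrbits.

(** * Automorphisms over the maximal real subfield *)

Section RealCyclotomicTower.
Variables (p r s : nat) (L : splittingFieldType rat) (iota : {rmorphism L -> algC}).
Variables (z zr : L) (K : {subfield L}).
Hypotheses (p_pr : prime p) (p_odd : odd p) (r_gt0 : (1 <= r)%N).
Hypotheses (z_prim : (p ^ (r + s)).-primitive_root z) (z_gen : <<1; z>>%VS = {:L}%VS).
Hypotheses (zr_prim : (p ^ r).-primitive_root zr).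
Hypothesis K_max : maximal_real_subfield iota <<1; zr>>%AS K.

Local Notation O := (int_closure L).
Local Notation F := <<1; zr>>%VS.
Local Notation N := (p ^ (r + s))%N.
Local Notation GK := ('Gal({:L} / K)%g).

Let z0 : z != 0. Proof. exact: prim_root_neq0 z_prim. Qed.

Lemma gal_of_aut (nu : {rmorphism algC -> algC}) :
  exists g : gal_of {:L}, forall x, iota (g x) = nu (iota x).
Proof.
have [f Df] := restrict_aut_to_normal_num_field iota nu.
have /kAut_to_gal[g _ Dg] : kAut 1 {:L} (linfun f).
  rewrite kAutfE; apply/kHomP_tmp; split=> [x /vlineP[a ->] | x y _ _].
    by rewrite lfunE /= linearZ /= rmorph1.
  by rewrite !lfunE /= rmorphM.
by exists g => x; rewrite -Dg ?memvf // lfunE /= Df.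
Qed.

(** The default [1] is never reached for [u] prime to [p]. *)
Definition cyc_gal (u : int) : gal_of {:L} :=
  odflt 1%g [pick g : gal_of {:L} | g z == z ^ u].

(** An automorphism of [algC] raising [N]-th roots of unity to the power [u] restricts to the normal
    field [L]. *)
Lemma cyc_galE (u : int) : coprimez u p -> cyc_gal u z = z ^ u.
Proof.
move=> co_u; rewrite /cyc_gal; case: pickP => [g /eqP //|no_g].
have N0 : N%:Z != 0 by have := prim_order_gt0 z_prim; lia.
pose k := `|(u %% N)%Z|%N.
have co_k : coprime k N.
  have : coprimez u N.
    by rewrite coprimezE /= coprimeXr // -coprimezE.
  by rewrite /coprimez -gcdz_modl.
have [nu Dnu] := Qn_aut_exists co_k; have [g Dg] := gal_of_aut nu.
have /eqP[] := no_g g; apply: (fmorph_inj iota).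
rewrite Dg Dnu -?rmorphXn ?(prim_expr_order z_prim) ?rmorph1 //=.
by rewrite (exprz_modz z_prim).
Qed.

Lemma cyc_gal_exp u m : coprimez u p -> cyc_gal u (z ^ m) = z ^ (u * m).
Proof. by move=> co_u; rewrite fmorphXz /= cyc_galE // exprz_exp. Qed.

Lemma root_mem_sub m : ((p ^ s)%N %| m)%Z -> z ^ m \in F.
Proof.
move=> /dvdzP[k ->].
have /(prim_rootP zr_prim)[i ->] : (z ^ (k * (p ^ s)%N)) ^+ (p ^ r) = 1.
  apply/eqP; rewrite exprnP exprz_exp -(prim_order_dvdz z_prim).
  by rewrite -mulrA -PoszM -expnD addnC dvdz_mull.
by rewrite rpredX ?memv_adjoin.
Qed.

Lemma coprimez_one_mod u : ((p ^ r)%N %| u - 1)%Z -> coprimez u p.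
Proof.
move=> u1; rewrite coprimez_sym coprimezE /= prime_coprime //; apply/negP=> pu.
have : (p %| u - (u - 1))%Z.
  rewrite rpredB //; apply: dvdz_trans u1.
  by rewrite dvdzE /= dvdn_exp.
by rewrite opprB addrC subrK dvdz1 /= => /eqP p1; move: p_pr; rewrite p1.
Qed.

(** [zr] is a power [z ^ i] with [p ^ s] dividing [i], so [u * i] and [i] agree modulo [N]. *)
Lemma cyc_gal_fix_sub u a :
  ((p ^ r)%N %| u - 1)%Z -> a \in F -> cyc_gal u a = a.
Proof.
move=> u1; have co_u := coprimez_one_mod u1; suff fix_zr : cyc_gal u zr = zr.
  move=> /Fadjoin_polyP[q Qq ->]; rewrite -horner_map /= fix_zr.
  by rewrite (fixedPoly_gal (sub1v _)) ?mem_gal1.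
have [i Dzr] : exists i : nat, zr = z ^ i.
  have /(prim_rootP z_prim)[i ->] : zr ^+ N = 1.
    by rewrite expnD exprM (prim_expr_order zr_prim) expr1n.
  by exists i.
rewrite Dzr cyc_gal_exp //; apply: (eq_prim_rootz z_prim).
rewrite -{2}[i%:Z]mul1r -mulrBl expnD PoszM dvdz_mul //.
have := prim_expr_order zr_prim; rewrite Dzr exprnP exprz_exp => /eqP.
rewrite -(prim_order_dvdz z_prim) addnC expnD PoszM dvdz_mul2r //.
by have : (0 < p ^ r)%N by [rewrite expn_gt0 prime_gt0]; lia.
Qed.

Lemma cyc_gal_mem u : ((p ^ r)%N %| u - 1)%Z -> cyc_gal u \in GK.
Proof.
move=> u1; rewrite gal_kHom ?subvf //; apply/kAHomP=> a Ka.
by apply: cyc_gal_fix_sub => //; have [/subvP sKF _ _] := K_max; apply: sKF.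
Qed.

Lemma root_conj m : (iota (z ^ m))^* = iota (z ^ (- m)).
Proof.
have zm0 : z ^ m != 0 by rewrite expfz_neq0.
have : `|iota (z ^ m)| = 1.
  apply/eqP; rewrite -(@pexpr_eq1 _ _ N) ?(prim_order_gt0 z_prim) //.
  rewrite -normrX -rmorphXn /= exprnP exprzAC -exprnP.
  by rewrite (prim_expr_order z_prim) exp1rz rmorph1 normr1.
move=> nz1; apply: (@mulfI _ (iota (z ^ m))); first by rewrite fmorph_eq0.
by rewrite -normCK nz1 expr1n -rmorphM /= -expfzDr // subrr expr0z rmorph1.
Qed.

Lemma cyc_gal_conj a : iota (cyc_gal (-1) a) = (iota a)^*.
Proof.
have [c Dc] := gal_of_aut (Num.conj : {rmorphism algC -> algC}).
suff -> : cyc_gal (-1) = c by rewrite Dc.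
apply: (gal_cyclotomic_inj z_gen); rewrite cyc_galE ?coprimeNz /coprimez ?gcd1z //.
by apply: (fmorph_inj iota); rewrite Dc -(root_conj 1).
Qed.

Lemma cyc_gal_conj_mem : cyc_gal (-1) \in GK.
Proof.
rewrite gal_kHom ?subvf //; apply/kAHomP=> a Ka.
apply: (fmorph_inj iota); rewrite cyc_gal_conj.
by have [_ realK _] := K_max; apply/CrealP/realK.
Qed.

(** The elements of [F] fixed by conjugation form a real subfield, to which maximality of [K]
    applies. *)
Lemma mem_real_sub a : a \in F -> cyc_gal (-1) a = a -> a \in K.
Proof.
move=> Fa ca; have [_ _ maxK] := K_max.
pose K' := (<<1; zr>> :&: fixedField [set cyc_gal (-1)])%AS.
have /subvP : (K' <= K)%VS.
  apply: maxK; first exact: capvSl.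
  move=> b; rewrite memv_cap => /andP[_ /fixedFieldP Kb].
  apply/CrealP; rewrite -cyc_gal_conj Kb ?memvf ?set11 //.
apply; rewrite memv_cap Fa; apply/fixedFieldP; first exact: memvf.
by move=> _ /set1P->.
Qed.

Lemma root_add_inv_real m : ((p ^ s)%N %| m)%Z -> z ^ m + z ^ (- m) \in K.
Proof.
move=> sm; apply: mem_real_sub; first by rewrite rpredD ?root_mem_sub ?rpredN.
by rewrite rmorphD /= !cyc_gal_exp ?coprimeNz /coprimez ?gcd1z // !mulN1r opprK addrC.
Qed.

Lemma root_integral m : z ^ m \in O.
Proof.
apply: (@int_closure_root1 _ _ N); first exact: prim_order_gt0 z_prim.
by rewrite exprnP exprzAC -exprnP (prim_expr_order z_prim) exp1rz.
Qed.

(** [O] is spanned over Z by the powers of [z], so integrality is tested on them. *)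
Lemma order_op_roots T :
  galalg_op K T -> (forall m, T (z ^ m) \in O) -> order_op K T.
Proof.
move=> [x Dx] OT; exists x => //; apply/assoc_orderP=> a.
rewrite (cyclotomic_integers p_pr _ z_prim z_gen) ?addn_gt0 ?r_gt0 //.
move=> /int_adjoin_spanP[c ->].
rewrite galalg_act_sum => [|i]; last by rewrite rpred_int.
apply: rpred_sum => i _; rewrite rpredM ?rpred_int // Dx.
exact: (OT i).
Qed.

(** * Projectors onto orbits *)

Section Projector.
Variable M : nat.
Hypothesis le_Ms : (M <= s)%N.

(** For [w < p ^ M] these are the units modulo [N] congruent to 1 modulo [p ^ (r + s - M)], that is,
    the automorphisms fixing [z ^ (p ^ M)]. *)
Definition twist (w : nat) : int := 1 + (p ^ (r + s - M))%N%:Z * w%:Z.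

Lemma twist_mod w : ((p ^ r)%N %| twist w - 1)%Z.
Proof.
rewrite /twist (addrC 1) addrK dvdz_mulr // dvdzE /=.
by rewrite dvdn_exp2l; lia.
Qed.

(* A finite Fourier transform over the automorphisms fixing [z ^ (p ^ M)], so
   that it selects the exponents congruent to [j] modulo [p ^ M]. *)
Definition projector (j : int) (b : L) : L :=
  \sum_(w < p ^ M) (p ^ M)%:R^-1 * z ^ (- ((p ^ (r + s - M))%N%:Z * w%:Z * j))
     * cyc_gal (twist w) b.

Lemma projectorE j m :
  projector j (z ^ m) = if ((p ^ M)%N %| m - j)%Z then z ^ m else 0.
Proof.
have om_prim : (p ^ M).-primitive_root (z ^+ (p ^ (r + s - M))).
  have := dvdn_prim_root z_prim (m := p ^ M).
  by rewrite -expnB ?prime_gt0 //; [apply; rewrite dvdn_exp2l|]; lia.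
have pM0 : (p ^ M)%:R != 0 :> L.
  by rewrite -(rmorph_nat (in_alg L)) fmorph_eq0 pnatr_eq0 -lt0n expn_gt0 prime_gt0.
transitivity ((p ^ M)%:R^-1 * z ^ m *
   \sum_(w < p ^ M) (z ^+ (p ^ (r + s - M))) ^ ((m - j) * w%:Z)).
  rewrite mulr_sumr; apply: eq_bigr => w _.
  rewrite cyc_gal_exp ?coprimez_one_mod ?twist_mod // -!mulrA; congr (_ * _).
  rewrite exprnP exprz_exp -!expfzDr //; congr (_ ^ _).
  by rewrite /twist; ring.
rewrite (sum_prim_rootz om_prim); case: ifP => _; last by rewrite mulr0.
by rewrite mulrAC mulVf // mul1r.
Qed.

Lemma projector0_order_op : order_op K (projector 0).
Proof.
apply: order_op_roots => [|m].
  apply: galalg_op_sum => w; rewrite mulr0 oppr0 expr0z mulr1.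
  apply: galalg_op_gal; first by rewrite rpredV rpred_nat.
  exact: cyc_gal_mem (twist_mod w).
by rewrite projectorE; case: ifP => _; rewrite ?rpred0 ?root_integral.
Qed.

(** At each automorphism the two coefficients are complex conjugates, in [F] by the divisibility
    conditions, so their sum is in [K]. On powers of [z] the denominators disappear. *)
Lemma projector_pair_order_op (j e : int) :
    ((p ^ s)%N %| e)%Z -> ((p ^ s)%N %| (p ^ (r + s - M))%N%:Z * j)%Z ->
  order_op K (fun b => z ^ e * projector j b + z ^ (- e) * projector (- j) b).
Proof.
move=> se sj; apply: order_op_roots => [|m].
  pose f (w : 'I_(p ^ M)) := (p ^ (r + s - M))%N%:Z * w%:Z * j.
  apply: (@eq_galalg_op _ _ (fun b => \sum_(w < p ^ M)
     (p ^ M)%:R^-1 * (z ^ (e - f w) + z ^ (- (e - f w))) * cyc_gal (twist w) b)).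
    move=> b; rewrite /projector !mulr_sumr -big_split; apply: eq_bigr => w _ /=.
    rewrite !mulrN -/(f w) !opprK opprB [f w - e]addrC !expfzDr //; ring.
  apply: galalg_op_sum => w; apply: galalg_op_gal.
    rewrite rpredM ?rpredV ?rpred_nat // root_add_inv_real // rpredB //.
    by rewrite /f mulrAC dvdz_mulr.
  exact: cyc_gal_mem (twist_mod w).
by rewrite rpredD // rpredM ?root_integral // projectorE;
  case: ifP => _; rewrite ?rpred0 ?root_integral.
Qed.

End Projector.

(** * The generator and the integers it generates *)

Let p_gt0 : (0 < p)%N. Proof. exact: prime_gt0. Qed.
Local Notation q := ((p ^ s)%N%:Z).
Local Notation orbit_mod := (orbit_mod p r s).
Local Notation orbit_rel := (orbit_rel p r s).
Local Notation orbit_rep := (orbit_rep p r s).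
Local Notation orbit_reps := (orbit_reps p r s).

Definition integral_generator : L := \sum_(j <- orbit_reps) z ^ j.

Lemma projector_sum M j :
  projector M j integral_generator = \sum_(k <- orbit_reps) projector M j (z ^ k).
Proof.
rewrite /projector exchange_big; apply: eq_bigr => w _ /=.
by rewrite raddf_sum mulr_sumr.
Qed.

Lemma projector0_generator : projector s 0 integral_generator = z ^ q.
Proof.
have q_rep : q \in orbit_reps.
  by have := orbit_rep_mem s p_pr r_gt0 q; rewrite /orbit_rep dvdzz.
rewrite projector_sum (bigD1_seq q) ?undup_uniq //= projectorE // subr0 dvdzz.
rewrite big_seq_cond big1 ?addr0 // => j /andP[Sj jq].
rewrite projectorE // subr0 ifN //; apply: contra jq => qj.
apply/eqP; apply: (orbit_reps_eq p_pr r_gt0 Sj q_rep).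
by rewrite /orbit_rel orbit_mod_top // rpredB.
Qed.

(** Only the term [j] survives the first projector. None survives the second: representatives are
    taken up to sign, and [j] is not in the class of [- j]. *)
Lemma projector_pair_generator M j e : (M <= s)%N ->
    j \in orbit_reps -> ~~ (q %| j)%Z -> orbit_mod j = (p ^ M)%N ->
  z ^ e * projector M j integral_generator
    + z ^ (- e) * projector M (- j) integral_generator = z ^ (e + j).
Proof.
move=> le_Ms Sj qj DM.
rewrite !projector_sum (bigD1_seq j) ?undup_uniq //= projectorE // subrr dvdz0.
rewrite big_seq_cond big1 ?addr0; last first.
  move=> k /andP[Sk kj]; rewrite projectorE // ifN //; apply: contra kj => dkj.
  apply/eqP/esym; apply: (orbit_reps_eq p_pr r_gt0 Sj Sk); apply/orP; left.
  by rewrite DM -opprB rpredN.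
rewrite big_seq_cond big1 ?mulr0 ?addr0 ?expfzDr //.
move=> k /andP[Sk _]; rewrite projectorE // ifN //; rewrite opprK -DM.
apply/negP=> dkj; have Djk : j = k.
  by apply: (orbit_reps_eq p_pr r_gt0 Sj Sk); apply/orP; right; rewrite addrC.
by move: dkj; rewrite -Djk; apply/negP/orbit_mod_double.
Qed.

Lemma cyc_gal_order_op u : cyc_gal u \in GK -> order_op K (fun b => cyc_gal u b).
Proof.
move=> Gu; have [x Ax Dx] := order_op_gal (rpred1 K) (rpred1 O) Gu.
by exists x => // b; rewrite Dx mul1r.
Qed.

Lemma root_generated_in_orbit j k :
    j \in orbit_reps -> ~~ (q %| j)%Z -> (orbit_mod j %| k - j)%Z ->
  exists2 T, order_op K T & T integral_generator = z ^ k.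
Proof.
move=> Sj qj dkj; have [M le_Ms DM] := orbit_modP r s p_pr j.
have sj : (q %| (p ^ (r + s - M))%N%:Z * j)%Z.
  have : ((p ^ M)%N %| (p ^ r)%N%:Z * j)%Z by rewrite -DM dvdz_gcdl.
  move=> /(dvdz_mul (dvdzz (p ^ (s - M))%N)).
  rewrite mulrA -!PoszM -!expnD subnK //.
  by have -> : (s - M + r = r + s - M)%N by lia.
(* For modulus [q], [z ^ (k - j)] lies in [F] and is absorbed as the factor [z ^ e]; otherwise an
   automorphism over [F] moves [j] to [k]. *)
have [Dq|nDq] := eqVneq (orbit_mod j) q.
  exists (fun b => z ^ (k - j) * projector M j b + z ^ (- (k - j)) * projector M (- j) b).
    by apply: projector_pair_order_op => //; rewrite -Dq.
  by rewrite projector_pair_generator // subrK.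
have [u u1 duk] := orbit_transitive p_pr r_gt0 nDq dkj.
exists (cyc_gal u \o (fun b => z ^ 0 * projector M j b + z ^ (- 0) * projector M (- j) b)).
  apply: order_op_comp; first exact/cyc_gal_order_op/cyc_gal_mem.
  by apply: projector_pair_order_op => //; rewrite dvdz0.
rewrite /= projector_pair_generator // add0r cyc_gal_exp ?coprimez_one_mod //.
by apply/esym/(eq_prim_rootz z_prim).
Qed.

(** A cyclotomic unit: it equals [z ^ (- q) * (y + 1)], and as [2 * h = p ^ r + 1] gives
    [(y ^+ 2) ^+ h = y], the inverse of [y + 1] is a geometric sum in [y ^+ 2]. *)
Lemma root_add_inv_invertible : exists2 e, e \in O & (z ^ q + z ^ (- q)) * e = 1.
Proof.
pose y := z ^ (2 * q); pose h := (p ^ r)./2.+1.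
have yr : y ^+ (p ^ r) = 1.
  apply/eqP; rewrite exprnP exprz_exp -(prim_order_dvdz z_prim).
  by rewrite -mulrA -PoszM -expnD addnC dvdz_mull.
have y1 : y != 1.
  rewrite -(prim_order_dvdz z_prim) expnD PoszM dvdz_mul2r; last first.
    by have : (0 < p ^ s)%N by [rewrite expn_gt0 p_gt0]; lia.
  rewrite dvdzE /=; apply/negP=> /dvdn_leq -/(_ isT).
  have : (p ^ 1 <= p ^ r)%N by rewrite leq_exp2l ?prime_gt1.
  have := prime_gt1 p_pr; case: p p_odd => [|[|[|p']]] // _ _; lia.
have y2h : (y ^+ 2) ^+ h = y.
  have -> : (y ^+ 2) ^+ h = y ^+ (p ^ r) * y.
    rewrite -exprM -exprSr; congr (_ ^+ _).
    have := odd_double_half (p ^ r); rewrite oddX p_odd orbT /h; lia.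
  by rewrite yr mul1r.
exists (z ^ q * \sum_(l < h) (y ^+ 2) ^+ l).
  rewrite rpredM ?root_integral // rpred_sum // => l _.
  by do 2!rewrite rpredX //; exact: root_integral.
apply: (@mulfI _ (y - 1)); first by rewrite subr_eq0.
have -> : (y - 1) * ((z ^ q + z ^ (- q)) * (z ^ q * \sum_(l < h) (y ^+ 2) ^+ l))
   = (y ^+ 2 - 1) * \sum_(l < h) (y ^+ 2) ^+ l.
  rewrite mulrA mulrA; congr (_ * _).
  have -> : (z ^ q + z ^ (- q)) = z ^ (- q) * (y + 1).
    rewrite mulrDr mulr1 /y -expfzDr //; congr (z ^ _ + _); ring.
  have zz : z ^ (- q) * z ^ q = 1 by rewrite -expfzDr // addNr.
  transitivity ((y - 1) * (y + 1) * (z ^ (- q) * z ^ q)); first by ring.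
  by rewrite zz; ring.
by rewrite -subrX1 y2h mulr1.
Qed.

Lemma subroot_generated (i : nat) :
  exists2 T, order_op K T & T (z ^ q) = z ^ (q * i%:Z).
Proof.
have [e Oe] := root_add_inv_invertible; set eps := _ + _ => De.
have Keps : eps \in K by rewrite root_add_inv_real.
have Oeps : eps \in O by rewrite rpredD ?root_integral.
have eps0 : eps != 0.
  by apply/eqP=> e0; move/eqP: De; rewrite e0 mul0r eq_sym oner_eq0.
have Ke : e \in K.
  have -> : e = eps^-1 by rewrite -[RHS]mulr1 -De mulKf.
  by rewrite rpredV.
(* The recurrence has order two, so two consecutive exponents are carried along. *)
suff [] : (exists2 T, order_op K T & T (z ^ q) = z ^ (q * i%:Z)) /\
          (exists2 T, order_op K T & T (z ^ q) = z ^ (q * i.+1%:Z)) by [].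
elim: i => [|i [[T opT DT] [T' opT' DT']]]; split; last 1 first.
- exists (fun b => ((fun b => eps * (1%g : gal_of {:L}) b) \o T') b - T b).
    apply: order_opB opT; apply: order_op_comp opT'.
    by apply: order_op_gal; rewrite ?group1.
  rewrite /= gal_id DT DT' mulrDl -!expfzDr //.
  have -> : q + q * i.+1%:Z = q * i.+2%:Z by rewrite -!natz; lia.
  have -> : - q + q * i.+1%:Z = q * i%:Z by rewrite -!natz; lia.
  by rewrite addrK.
(* Exponent 0: [z ^ q] plus its conjugate is [eps], and [e] is its inverse. *)
- exists (fun b => e * (1%g : gal_of {:L}) b + e * cyc_gal (-1) b).
    apply: order_opD; apply: order_op_gal; rewrite ?group1 //.
    exact: cyc_gal_conj_mem.
  rewrite gal_id cyc_gal_exp ?coprimeNz /coprimez ?gcd1z // mulN1r -mulrDr.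
  by rewrite mulrC De mulr0.
- exists (fun b => 1 * (1%g : gal_of {:L}) b).
    by apply: order_op_gal; rewrite ?rpred1 ?group1.
  by rewrite gal_id mul1r mulr1.
- by exists T'.
Qed.

Lemma root_generated (k : int) :
  exists2 T, order_op K T & T integral_generator = z ^ k.
Proof.
have [/dvdzP[i Dk]|qk] := boolP (q %| k)%Z.
  (* [z ^ q] has order [p ^ r], so [i] may be replaced by its residue, a natural number. *)
  have [T opT DT] := subroot_generated `|(i %% (p ^ r)%N)%Z|%N.
  exists (T \o projector s 0).
    by apply: order_op_comp => //; apply: projector0_order_op.
  rewrite /= projector0_generator DT Dk; apply: (eq_prim_rootz z_prim).
  have pr0 : (p ^ r)%N%:Z != 0.
    by have : (0 < p ^ r)%N by [rewrite expn_gt0 p_gt0]; lia.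
  rewrite gez0_abs ?modz_ge0 // [i * q]mulrC -mulrBr addnC expnD PoszM dvdz_mul //.
  by rewrite -opprB rpredN {1}(divz_eq i (p ^ r)%N) addrK dvdz_mull.
have Rkj := orbit_rep_rel p r s k; have Sj := orbit_rep_mem s p_pr r_gt0 k.
move: Rkj Sj; set j := orbit_rep k => Rkj Sj.
have qj : ~~ (q %| j)%Z by rewrite -(orbit_rel_dvd p_pr r_gt0 Rkj).
have Dm := orbit_rel_mod p_pr r_gt0 Rkj.
have /orP[dkj|dkj] := Rkj; rewrite -Dm in dkj.
  exact: root_generated_in_orbit dkj.
(* Here [- k] is in the class of [j]: reach [z ^ (- k)], then conjugate. *)
have [|T opT DT] := @root_generated_in_orbit j (- k) Sj qj.
  by rewrite -opprD rpredN.
exists (cyc_gal (-1) \o T).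
  by apply: order_op_comp => //; apply: cyc_gal_order_op; apply: cyc_gal_conj_mem.
by rewrite /= DT cyc_gal_exp ?coprimeNz /coprimez ?gcd1z // mulN1r opprK.
Qed.

Lemma integer_generated a :
  a \in O -> exists2 T, order_op K T & T integral_generator = a.
Proof.
rewrite (cyclotomic_integers p_pr _ z_prim z_gen) ?addn_gt0 ?r_gt0 //.
move=> /int_adjoin_spanP[c ->].
elim/big_ind: _ => [|_ _ [T1 op1 <-] [T2 op2 <-]|i _].
- have [T opT _] := root_generated 0; exists (fun b => T b - T b).
    exact: order_opB.
  by rewrite subrr.
- by exists (fun b => T1 b + T2 b); first exact: order_opD.
have [T opT DT] := root_generated i.
exists ((fun b => (c`_i)%:~R * (1%g : gal_of {:L}) b) \o T).
  by apply: order_op_comp => //; apply: order_op_gal; rewrite ?rpred_int ?group1.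
by rewrite /= gal_id DT.
Qed.

(** The powers of [z] are integral and span [L] over Q. *)
Lemma galalg_act_integers_inj (x : galalg K) :
  {in O, galalg_act x =1 (fun _ => 0)} -> x = 0.
Proof.
move=> x0; apply: galalg_act_inj => a.
have /Fadjoin_polyP[f Qf ->] : a \in <<1; z>>%VS by rewrite z_gen memvf.
rewrite horner_coef galalg_act_sum => [|i]; last first.
  by apply: (subvP (sub1v K)); apply: (polyOverP Qf).
by rewrite big1 // => i _; rewrite x0 ?mulr0 // (root_integral i).
Qed.

Lemma real_cyclotomic_leopoldt : leopoldt K.
Proof.
have abG := gal_cyclotomic_abelian z_prim z_gen.
split=> //; first exact: num_field_galois.
apply: (@assoc_order_free_rank1 _ _ integral_generator).
- exact: abelianS (galS _ (sub1v K)) abG.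
- by apply: rpred_sum => j _; apply: root_integral.
- exact: galalg_act_integers_inj.
- exact: integer_generated.
Qed.

End RealCyclotomicTower.

Theorem theorem1p3 (p r s : nat) (L : splittingFieldType rat)
    (iota : {rmorphism L -> algC}) (zeta_rs zeta_r : L) (K : {subfield L}) :
  prime p -> odd p -> (1 <= r)%N ->
  (p ^ (r + s)).-primitive_root zeta_rs ->
  <<1; zeta_rs>>%VS = {:L}%VS ->
  (p ^ r).-primitive_root zeta_r ->
  maximal_real_subfield iota <<1; zeta_r>>%AS K ->
  leopoldt K.
Proof.
move=> p_pr p_odd r_gt0 z_prim z_gen zr_prim K_max.
exact: (real_cyclotomic_leopoldt p_pr p_odd r_gt0 z_prim z_gen zr_prim K_max).
Qed.
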